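(* Let $k$ be a subfield of $\mathbb{C}$, $V$ a finite-dimensional $k$-vector space, $A$ a finite arrangement of linear hyperplanes in $V$ with intersection lattice $L$, and $U=\bigcap_{a\in A}a$. Let $F$ be the natural sheaf on $L$ and $\Lambda^jF$ its $j$-th exterior power. If $rk L\ge 2$ and $\widetilde L\to L$ is the Boolean cover of $L$, then $\mathrm{HC}_i(\widetilde L;\Lambda^jF)=0$ unless $0\le i<rk L$ and $rk L\le i+j\le\dim V$, in which case $$\dim\mathrm{HC}_i(\widetilde L;\Lambda^jF)=\frac{(-1)^i}{(rk L-i)!}\binom{\dim U}{i+j-rk L}\chi^{(rk L-i)}_{(L,F^\perp)}(1),$$ where $\chi^{(m)}_{(L,F^\perp)}(t)$ is the $m$-th derivative of $\chi_{(L,F^\perp)}(t)=\sum_{x\in L}\mu_L(\mathbf{0},x)t^{\dim x-\dim U}$.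
   Context: The intersection lattice $L$ consists of all intersections of subsets of $A$ (empty intersection $=V$), ordered by reverse inclusion, with $rk(x)=\operatorname{codim}x$, minimum $\mathbf{0}=V$, maximum $U$, $rk L:=\operatorname{codim}U$; atoms are the hyperplanes; join is intersection. Möbius function: $\mu_L(x,x)=1$, $\mu_L(x,y)=-\sum_{x\le z<y}\mu_L(x,z)$. ($\chi_{(L,F^\perp)}$ is the characteristic polynomial of the essentialisation, the essential arrangement $\{U^\perp\cap a\}$ in an orthogonal complement of $U$, which has the same lattice $L$.) A sheaf $G$ on a poset assigns a $k$-vector space $G(x)$ to each element and a linear map $G^y_x:G(y)\to G(x)$ to each $x\le y$, functorially. The natural sheaf has $F(x)=x$ and $F^y_x$ the inclusion $y\subseteq x$; $(\Lambda^jF)(x)=\Lambda^j(F(x))$ with maps $\Lambda^j(F^y_x)$. Boolean cover: $\widetilde L$ is the lattice of subsets of $A$ under inclusion, $f(S)=\bigcap_{a\in S}a$ (the join in $L$; $f(\varnothing)=V$); the induced sheaf is $G(S)=G(f(S))$ with maps $G^{f(T)}_{f(S)}$. Cellular homology of a Boolean lattice $B$ of subsets of $\{a_1,\dots,a_n\}$ with sheaf $G$: $C_k=\bigoplus_{|x|=k}G(x)$, $d=\sum\varepsilon^x_yG^x_y$ over $y\subset x$, $|y|=|x|-1$, with $\varepsilon^x_y=(-1)^{j-1}$ when $x=\{a_{i_1},\dots,a_{i_k}\}$ ($i_1<\cdots<i_k$), $y=x\setminus\{a_{i_j}\}$; $\mathrm{HC}_*$ is its homology. *)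

(* Defs.v *)
From HB Require Import structures.
From mathcomp Require Import all_boot all_order all_algebra all_fingroup.
From mathcomp Require Import complex.
Export ComplexField.
From mathcomp Require Export Rstruct.

Set Implicit Arguments.
Unset Strict Implicit.
Unset Printing Implicit Defensive.
Import Order.TTheory GRing.Theory Num.Theory.
Local Open Scope ring_scope.

Notation Cplx := (complex Rdefinitions.R).

Section Arrangement.
Variables (k : fieldType) (vT : vectType k).
Local Notation n := (\dim {:vT}).

Definition crd (i : 'I_n) (v : vT) : k := coord (vbasis {:vT}) i v.

(* Ambient space for exterior powers: Lambda^j V is realised as the space of
   alternating tensors inside V^{(x) j}, written in coordinates: a tensor is a
   function from multi-indices ('I_j -> 'I_n) to k. *)
Definition tens (j : nat) := {ffun {ffun 'I_j -> 'I_n} -> k^o}.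

(* w_1 /\ ... /\ w_j, i.e. sum_pi sgn(pi) w_{pi 1} (x) ... (x) w_{pi j}. *)
Definition wedge (j : nat) (w : 'I_j -> vT) : tens j :=
  [ffun s : {ffun 'I_j -> 'I_n} => \det (\matrix_(a < j, b < j) crd (s b) (w a))].

(* Lambda^j x for a subspace x of V: spanned by wedges of j elements of x
   (equivalently, of j basis vectors of x); it sits inside Lambda^j V. *)
Definition ext (j : nat) (x : {vspace vT}) : {vspace tens j} :=
  <<[seq wedge (fun a => tnth (vbasis x) (f a)) | f : {ffun 'I_j -> 'I_(\dim x)}]>>%VS.

Variables (m : nat) (H : 'I_m -> {vspace vT}).

Definition fS (X : {set 'I_m}) : {vspace vT} := (\bigcap_(i in X) H i)%VS.

Definition Uarr : {vspace vT} := fS setT.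

Definition Lat : seq {vspace vT} := undup [seq fS X | X <- enum {set 'I_m}].

Definition rkL : nat := (n - \dim Uarr)%N.

(* Moebius function mu_L(0, y), 0 = V, order = reverse inclusion:
   mu(0,0) = 1, mu(0,y) = - sum_{0 <= z < y} mu(0,z).  Computed by recursion
   with fuel; fuel n.+1 is sufficient since chains in L have length <= n. *)
Fixpoint mob_fuel (fuel : nat) (y : {vspace vT}) : int :=
  if y == fullv then 1 else
  match fuel with
  | 0 => 0
  | fuel'.+1 => - \sum_(z <- Lat | (y <= z)%VS && (y != z)) mob_fuel fuel' z
  end.

Definition mobL (y : {vspace vT}) : int := mob_fuel n.+1 y.

Definition chiL : {poly rat} :=
  \sum_(x <- Lat) ((mobL x)%:~R *: 'X^(\dim x - \dim Uarr)).

(* Cellular chains of the Boolean lattice with coefficients in Lambda^j F: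
   C_p = (+)_{|S| = p} Lambda^j(f S), realised inside functions
   {set 'I_m} -> Lambda^j V.  All restriction maps of Lambda^j F are
   Lambda^j of inclusions, i.e. the identity on the ambient tensors. *)
Definition chains (j : nat) := {ffun {set 'I_m} -> tens j}.

Definition single (j : nat) (X : {set 'I_m}) (t : tens j) : chains j :=
  [ffun Y => if Y == X then t else 0].

Definition Cgrp (j p : nat) : {vspace chains j} :=
  (\sum_(X : {set 'I_m} | #|X| == p) (linfun (single X) @: ext j (fS X)))%VS.

(* eps^x_y = (-1)^(j-1) when y = x \ {a_{i_j}}: j-1 = #{a in x | a < removed} *)
Definition eps (X : {set 'I_m}) (i : 'I_m) : k :=
  (-1) ^+ #|[set a in X | (a < i)%N]|.

Definition bd (j : nat) (c : chains j) : chains j :=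
  [ffun Y : {set 'I_m} => \sum_(i : 'I_m | i \notin Y) eps (i |: Y) i *: c (i |: Y)].

Lemma bd_is_linear j : linear (@bd j).
Proof.
move=> a c c'; apply/ffunP => Y; rewrite !ffunE.
rewrite scaler_sumr -big_split /=; apply: eq_bigr => i _.
by rewrite !ffunE scalerDr !scalerA mulrC.
Qed.

Definition dimHC (p j : nat) : nat :=
  (\dim (Cgrp j p :&: lker (linfun (@bd j))) - \dim (linfun (@bd j) @: Cgrp j p.+1))%N.

End Arrangement.

(* Main.v *)
Require Import Defs.
From HB Require Import structures.
From mathcomp Require Import all_boot all_order all_algebra all_fingroup.
From mathcomp Require Import zify ring.
Import Order.TTheory GRing.Theory Num.Theory.
Local Open Scope ring_scope.
Set Implicit Arguments.
Unset Strict Implicit.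
Unset Printing Implicit Defensive.

(** Replace the ambient space by an arbitrary subspace [X] and the arrangement
    by an arbitrary subfamily [D].  For a hyperplane [a] in [D] the chain
    complex is the mapping cone of the inclusion of the complex of the
    restriction (inside [X :&: H a]) into that of the deletion.  If [H a] is
    transversal to the intersection of the others, contraction with a linear
    form defining [H a] identifies the quotient of this inclusion with the
    complex of the restriction in exterior degree one less.  By induction the
    homology vanishes in degree [p] unless [r <= p + j <= dim X], where [r] is
    the rank.  If the common intersection [U] is zero, a single degree survives
    and the Euler characteristic computes its dimension.  In general one
    splits off a line [e] of [U]: contraction and exterior multiplication by
    [e] give a split short exact sequence of complexes, hence Pascal's rule and
    the factor ['C(dim U, p + j - r)].  Finally, Whitney's theorem
    [mu(0, x) = sum of (-1)^|S| over the S with intersection x] turns the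
    alternating sums of binomials into derivatives of the characteristic
    polynomial at [1]. *)

(** * Determinant identities behind the calculus of wedges *)

Section Determinants.
Variable R : comNzRingType.

(** Leibniz expansion with the inner sums distributed over the rows: Cauchy-Binet before the
    non-injective [f] are discarded. *)
Lemma det_mulmx_sum j d (A : 'M[R]_(j, d)) (B : 'M[R]_(d, j)) :
  \det (A *m B) = \sum_(f : {ffun 'I_j -> 'I_d})
    (\prod_a A a (f a)) * \det (\matrix_(a, b) B (f a) b).
Proof.
under [RHS]eq_bigr do rewrite mulr_sumr.
rewrite exchange_big /=; apply: eq_bigr => s _.
under eq_bigr do rewrite mxE.
rewrite bigA_distr_bigA mulr_sumr; apply: eq_bigr => f _.
rewrite big_split /= mulrCA; congr (_ * (_ * _)).
by apply: eq_bigr => a _; rewrite mxE.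
Qed.

(** A column operation, realised as right multiplication by the unitriangular [T]. *)
Lemma det_row_mx_subl j (l : 'cV[R]_j.+1) (W : 'M[R]_(j.+1, j)) (e : 'rV[R]_j) :
  \det (row_mx l (W - l *m e) : 'M_j.+1) = \det (row_mx l W : 'M_j.+1).
Proof.
pose T : 'M[R]_(1 + j) := block_mx 1%:M (- e) 0 1%:M.
have dT : \det T = 1 by rewrite det_ublock !det1 mulr1.
rewrite -[RHS]mulr1 -dT -[RHS](det_mulmx (row_mx l W : 'M_(1 + j)) T).
by congr (\det _); rewrite mul_row_block !mulmx1 mulmx0 addr0 mulmxN addrC.
Qed.

(** Eliminating [l] below the corner [1] leaves the Schur complement. *)
Lemma det_block_mx1 j (e : 'rV[R]_j) (l : 'cV[R]_j) (W : 'M[R]_j) :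
  \det (block_mx 1%:M e l W) = \det (W - l *m e).
Proof.
have -> : block_mx 1%:M e l W =
  block_mx 1%:M 0 l 1%:M *m block_mx 1%:M e 0 (W - l *m e).
  by rewrite mulmx_block !mulmx1 !mul1mx !mulmx0 !mul0mx !addr0 addrC subrK.
by rewrite det_mulmx det_lblock det_ublock !det1 !mul1r.
Qed.

Lemma row_mx_ord0 p j (l : 'cV[R]_p) (W : 'M[R]_(p, j)) a :
  (row_mx l W : 'M_(p, j.+1)) a ord0 = l a ord0.
Proof.
rewrite -(row_mxEl l W a ord0); congr (fun_of_matrix _ _ _).
exact: val_inj.
Qed.

Lemma row_mx_lift0 p j (l : 'cV[R]_p) (W : 'M[R]_(p, j)) a b :
  (row_mx l W : 'M_(p, j.+1)) a (lift ord0 b) = W a b.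
Proof.
rewrite -(row_mxEr l W a b); congr (fun_of_matrix _ _ _).
exact: val_inj.
Qed.

End Determinants.

Definition fcons (T : Type) j (q : T) (s : 'I_j -> T) (b : 'I_j.+1) : T :=
  if unlift ord0 b is Some b' then s b' else q.

Lemma fcons0 (T : Type) j (q : T) (s : 'I_j -> T) : fcons q s ord0 = q.
Proof. by rewrite /fcons unlift_none. Qed.

Lemma fconsS (T : Type) j (q : T) (s : 'I_j -> T) b :
  fcons q s (lift ord0 b) = s b.
Proof. by rewrite /fcons liftK. Qed.

(** * Exterior powers as alternating tensors; contraction and exterior multiplication *)

Section Exterior.
Variables (k : fieldType) (vT : vectType k).
Local Notation n := (\dim {:vT}).
Implicit Types (x y : {vspace vT}) (e : vT) (j : nat).

Lemma crd_is_scalar (q : 'I_n) : scalar (@crd k vT q).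
Proof. by move=> a u v; rewrite /crd linearP. Qed.
HB.instance Definition _ (q : 'I_n) :=
  GRing.isLinear.Build k vT k *%R (@crd k vT q) (crd_is_scalar q).

Lemma scalar_crd (lam : {scalar vT}) v :
  lam v = \sum_(q < n) lam (vbasis {:vT})`_q * crd q v.
Proof.
rewrite {1}(coord_vbasis (memvf v)) linear_sum; apply: eq_bigr => q _.
by rewrite linearZ /= mulrC.
Qed.

Lemma eq_wedge j (w w' : 'I_j -> vT) : w =1 w' -> wedge w = wedge w'.
Proof.
move=> eqw; apply/ffunP => s; rewrite !ffunE; congr (\det _).
by apply/matrixP => a b; rewrite !mxE eqw.
Qed.

(** Multilinearity: once the [w a] are expanded in the basis of [x], [det_mulmx_sum] distributes the
    coefficients. *)
Lemma wedge_in_ext j x (w : 'I_j -> vT) :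
  (forall a, w a \in x) -> wedge w \in ext j x.
Proof.
move=> wx; pose C := \matrix_(a < j, c < \dim x) coord (vbasis x) c (w a).
suff -> : wedge w = \sum_(f : {ffun 'I_j -> 'I_(\dim x)})
    (\prod_a C a (f a)) *: wedge (fun a => tnth (vbasis x) (f a)).
  apply: memv_suml => f _; apply: memvZ; apply: memv_span.
  by apply/imageP; exists f.
apply/ffunP => s; rewrite ffunE sum_ffunE.
pose B := \matrix_(c < \dim x, b < j) crd (s b) (tnth (vbasis x) c).
have -> : \matrix_(a < j, b < j) crd (s b) (w a) = C *m B.
  apply/matrixP => a b; rewrite !mxE {1}(coord_vbasis (wx a)) linear_sum.
  by apply: eq_bigr => c _; rewrite linearZ /= !mxE (tnth_nth 0).
rewrite det_mulmx_sum; apply: eq_bigr => f _; rewrite !ffunE; congr (_ * \det _).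
by apply/matrixP => a b; rewrite !mxE.
Qed.

(** Linear maps are thus tested on wedges only; identities between maps on [ext j x] follow by
    taking [Z] to be zero. *)
Lemma limg_ext_sub j x (rT : vectType k) (f : 'Hom(tens vT j, rT)) (Z : {vspace rT}) :
  (forall w : 'I_j -> vT, (forall a, w a \in x) -> f (wedge w) \in Z) ->
  (f @: ext j x <= Z)%VS.
Proof.
move=> fw; rewrite /ext limg_span; apply/span_subvP => _ /mapP[_ /imageP[g _ ->] ->].
by apply: fw => a; rewrite vbasis_mem // mem_tnth.
Qed.

Lemma extS j x y : (x <= y)%VS -> (ext j x <= ext j y)%VS.
Proof.
move=> /subvP xy; rewrite -[ext j x]lim1g; apply: limg_ext_sub => w wx.
by rewrite id_lfunE wedge_in_ext // => a; apply: xy.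
Qed.

Lemma ext0 x : ext 0 x = fullv.
Proof.
apply/eqP; rewrite eqEsubv subvf; apply/subvP => t _.
(* The empty multi-index is the only one of length 0, and the empty wedge has coordinate 1 there. *)
pose s0 : {ffun 'I_0 -> 'I_n} := [ffun i : 'I_0 => False_rect _ (notF (ltn_ord i))].
have eqs (s : {ffun 'I_0 -> 'I_n}) : s = s0 by apply/ffunP; case.
have -> : t = (t s0 : k) *: wedge (fun a : 'I_0 => 0).
  by apply/ffunP => s; rewrite !ffunE (eqs s) det_mx00 [_ *: _]mulr1.
by apply: memvZ; apply: wedge_in_ext; case.
Qed.

(** Interior product: the form [lam], given by its values on the basis, is inserted in the first
    tensor slot. *)
Definition contract j (lam : vT -> k) (t : tens vT j.+1) : tens vT j :=
  [ffun s : {ffun 'I_j -> 'I_n} =>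
    \sum_(q < n) lam (vbasis {:vT})`_q * t [ffun b => fcons q s b]].

(** On wedges this puts [e] in front; the signs are those of the Laplace expansion along the row of
    [e]. *)
Definition extmul j e (t : tens vT j) : tens vT j.+1 :=
  [ffun s : {ffun 'I_j.+1 -> 'I_n} =>
    \sum_(b < j.+1) (-1) ^+ b * crd (s b) e * t [ffun b' => s (lift b b')]].

Lemma contract_is_linear j lam : linear (@contract j lam).
Proof.
move=> a t t'; apply/ffunP => s; rewrite !ffunE scaler_sumr -big_split /=.
by apply: eq_bigr => q _; rewrite !ffunE mulrDr; congr (_ + _); apply: mulrCA.
Qed.
HB.instance Definition _ j lam :=
  GRing.isLinear.Build k (tens vT j.+1) (tens vT j) *:%R (@contract j lam)
    (contract_is_linear lam).

Lemma extmul_is_linear j e : linear (@extmul j e).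
Proof.
move=> a t t'; apply/ffunP => s; rewrite !ffunE scaler_sumr -big_split /=.
by apply: eq_bigr => q _; rewrite !ffunE mulrDr; congr (_ + _); apply: mulrCA.
Qed.
HB.instance Definition _ j e :=
  GRing.isLinear.Build k (tens vT j) (tens vT j.+1) *:%R (@extmul j e)
    (extmul_is_linear e).

(** A determinant is linear in its first column, so summing over the first index fills that column
    with the values of [lam]. *)
Lemma contract_wedge_det j (lam : {scalar vT}) (w : 'I_j.+1 -> vT) s :
  contract lam (wedge w) s =
  \det (row_mx (\col_a lam (w a)) (\matrix_(a, b) crd (s b) (w a)) : 'M_j.+1).
Proof.
rewrite ffunE (expand_det_col _ ord0).
under eq_bigr => q _ do rewrite ffunE (expand_det_col _ ord0) mulr_sumr.
rewrite exchange_big; apply: eq_bigr => a _ /=.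
rewrite row_mx_ord0 [in RHS]mxE [in RHS]scalar_crd mulr_suml; apply: eq_bigr => q _.
rewrite !mxE ffunE fcons0 -mulrA; congr (_ * (_ * (_ * \det _))).
apply/matrixP => a' b; rewrite [LHS]mxE [LHS]mxE [LHS]mxE ffunE fconsS.
by rewrite [RHS]mxE [RHS]mxE row_mx_lift0 mxE.
Qed.

Lemma det_row_mx_wedge j (l : 'I_j.+1 -> k) (w : 'I_j.+1 -> vT) (s : {ffun 'I_j -> 'I_n}) :
  \det (row_mx (\col_a l a) (\matrix_(a, b) crd (s b) (w a)) : 'M_j.+1) =
  \sum_(a < j.+1) (-1) ^+ a * l a * wedge (fun b => w (lift a b)) s.
Proof.
rewrite (expand_det_col _ ord0); apply: eq_bigr => a _.
rewrite row_mx_ord0 mxE.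
rewrite /cofactor addn0 mulrCA mulrA ffunE; congr (_ * \det _).
apply/matrixP => a' b; rewrite [LHS]mxE [LHS]mxE row_mx_lift0.
by rewrite !mxE.
Qed.

Lemma contract_wedge j (lam : {scalar vT}) (w : 'I_j.+1 -> vT) :
  contract lam (wedge w) =
  \sum_(a < j.+1) ((-1) ^+ a * lam (w a)) *: wedge (fun b => w (lift a b)).
Proof.
apply/ffunP => s; rewrite contract_wedge_det det_row_mx_wedge sum_ffunE.
by apply: eq_bigr => a _; rewrite !ffunE.
Qed.

(* Subtracting multiples of the column of values of [lam] lets every [w a] be
   projected along [e] without changing the contraction. *)
Lemma contract_wedge_proj j (lam : {scalar vT}) e (w : 'I_j.+1 -> vT) :
  contract lam (wedge w) = \sum_(a < j.+1) ((-1) ^+ a * lam (w a)) *: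
    wedge (fun b => w (lift a b) - lam (w (lift a b)) *: e).
Proof.
apply/ffunP => s; rewrite contract_wedge_det sum_ffunE.
pose W := \matrix_(a, b) crd (s b) (w a - lam (w a) *: e).
transitivity (\det (row_mx (\col_a lam (w a)) W : 'M_j.+1)); last first.
  rewrite (det_row_mx_wedge _ (fun a => w a - lam (w a) *: e)).
  by apply: eq_bigr => a _; rewrite !ffunE.
rewrite -(det_row_mx_subl _ _ (\row_b crd (s b) e)).
suff -> : W = \matrix_(a, b) crd (s b) (w a) -
    (\col_a lam (w a)) *m (\row_b crd (s b) e) by [].
apply/matrixP => a b; rewrite !mxE big_ord1 !mxE linearB linearZ /=.
by congr (_ - _).
Qed.

Lemma extmul_wedge j e (w : 'I_j -> vT) :
  extmul e (wedge w) = wedge (fcons e w).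
Proof.
apply/ffunP => s; rewrite !ffunE (expand_det_row _ ord0); apply: eq_bigr => b _.
rewrite !mxE fcons0 /cofactor add0n ffunE mulrCA mulrA; congr (_ * \det _).
by apply/matrixP => a b'; rewrite !mxE ffunE fconsS.
Qed.

(* Two evaluations of the determinant of [1, e; lam w, w]: by expansion along
   the first column, and by its Schur complement. *)
Lemma wedge_proj j (lam : {scalar vT}) e (w : 'I_j.+1 -> vT) :
  wedge w - extmul e (contract lam (wedge w)) =
  wedge (fun a => w a - lam (w a) *: e).
Proof.
rewrite contract_wedge linear_sum /=.
under eq_bigr do rewrite linearZ /= extmul_wedge.
apply/ffunP => s; rewrite [RHS]ffunE.
pose W := \matrix_(a, b) crd (s b) (w a).
have -> : \matrix_(a, b) crd (s b) (w a - lam (w a) *: e) =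
    W - (\col_a lam (w a)) *m (\row_b crd (s b) e).
  apply/matrixP => a b; rewrite !mxE big_ord1 !mxE linearB linearZ /=.
  by congr (_ - _).
rewrite -det_block_mx1 (expand_det_col _ (lshift _ ord0)).
rewrite big_split_ord /= big_ord1 block_mxEul mxE eqxx mul1r.
rewrite !ffunE sum_ffunE; congr (_ + _).
  rewrite /cofactor /= expr0 mul1r; congr (\det _).
  apply/matrixP => a b; rewrite [LHS]mxE [RHS]mxE [RHS]mxE.
  have E (c : 'I_j.+1) : lift (lshift j.+1 (ord0 : 'I_1)) c = rshift 1 c by apply: val_inj.
  by rewrite !E block_mxEdr mxE.
rewrite -sumrN; apply: eq_bigr => a _.
rewrite block_mxEdl mxE !ffunE /cofactor /= addn0 exprS mulN1r mulNr mulrN.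
congr (- _); rewrite [RHS]mulrA [in RHS](mulrC (lam _)).
congr (_ * \det _).
apply/matrixP => a' b; rewrite [RHS]mxE [RHS]mxE [LHS]mxE.
have E (c : 'I_j.+1) : lift (lshift j.+1 (ord0 : 'I_1)) c = rshift 1 c by apply: val_inj.
rewrite E; case: (unliftP ord0 a') => [c|] ->.
  have -> : lift (rshift 1 a) (lift ord0 c) = rshift 1 (lift a c).
    by apply: val_inj; rewrite /= /bump /= !add1n !ltnS addnS.
  by rewrite block_mxEdr mxE fconsS.
have -> : lift (rshift 1 a) ord0 = lshift j.+1 (ord0 : 'I_1) by apply: val_inj.
by rewrite block_mxEur mxE fcons0.
Qed.

End Exterior.

(** * Splitting exterior powers along a line and a complementary hyperplane *)

Section Splitting.
Variables (k : fieldType) (vT : vectType k).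
Implicit Types (x y W : {vspace vT}) (e : vT) (j : nat).

Lemma dim_cap_hyperplane W x :
  (\dim W).+1 = \dim {:vT} -> ~~ (x <= W)%VS -> \dim x = (\dim (x :&: W)).+1.
Proof.
move=> dW nxW; have := dimv_sum_cap x W.
suff -> : \dim (x + W) = (\dim W).+1 by lia.
apply/eqP; rewrite eqn_leq {1}dW dimvS ?subvf //=.
rewrite ltn_neqAle dimvS ?addvSr // andbT; apply: contra nxW => /eqP dE.
have /eqP -> : W == (x + W)%VS by rewrite eqEdim addvSr dE /=.
exact: addvSl.
Qed.

(** Here [lam] is the coordinate along [e] when the space is the line of [e] plus [W]; the last
    clause describes the projection onto [W] along [e]. *)
Definition split_form W e (lam : vT -> k) :=
  [/\ lam e = 1, forall v, v \in W -> lam v = 0 & forall v, v - lam v *: e \in W].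

Lemma exists_split_form W e : (\dim W).+1 = \dim {:vT} -> e \notin W ->
  exists lam : {scalar vT}, split_form W e lam.
Proof.
move=> dW eW.
have e0 : e != 0 by apply: contra eW => /eqP ->; apply: mem0v.
have cap0 : (<[e]> :&: W = 0)%VS.
  apply/eqP; rewrite -dimv_eq0 -eqSS -dim_cap_hyperplane ?dim_vline ?e0 //.
have full v : v \in (<[e]> + W)%VS.
  suff -> : (<[e]> + W)%VS = fullv by apply: memvf.
  apply/eqP; rewrite eqEdim subvf -dW -(add1n (\dim W)).
  have := dimv_sum_cap <[e]> W; rewrite cap0 dimv0 addn0 dim_vline e0.
  by move=> ->; apply: leqnn.
pose p := daddv_pi <[e]> W.
pose lam := [eta coord [tuple e] ord0 \o p : vT -> k].
have lam_lin : scalar lam by move=> a u v; rewrite /lam /= !linearP.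
pose L : {scalar vT} := HB.pack lam (GRing.isLinear.Build k vT k *%R lam lam_lin).
have pE v : p v = lam v *: e.
  have : p v \in <<[tuple e]>>%VS by rewrite span_seq1 memv_pi.
  by move/coord_span; rewrite big_ord1.
exists L; split => [|v vW|v] /=; last first.
- rewrite -{1}(daddv_pi_add cap0 (full v)) -/p pE addrC addKr.
  exact: memv_pi.
- have := daddv_pi_add cap0 (full v); rewrite -/p pE.
  rewrite (daddv_pi_id _ vW) 1?capvC // => /(canRL (addrK _)).
  by rewrite subrr => /eqP; rewrite scaler_eq0 (negPf e0) orbF => /eqP.
have := pE e; rewrite /p daddv_pi_id ?memv_line // => /eqP.
rewrite -subr_eq0 -[X in X - _]scale1r -scalerBl scaler_eq0 (negPf e0) orbF.
by rewrite subr_eq0 => /eqP.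
Qed.

Section Fixed.
Variables (W : {vspace vT}) (e : vT) (lam : {scalar vT}).
Hypothesis lamP : split_form W e lam.

(** As [e] lies in [x], the projected vectors of [contract_wedge_proj] stay in [x] while falling
    into [W]. *)
Lemma contract_ext j x (t : tens vT j.+1) : e \in x ->
  t \in ext j.+1 x -> contract lam t \in ext j (x :&: W)%VS.
Proof.
move=> ex tx; case: lamP => _ _ We.
have /subvP S : (linfun (@contract k vT j lam) @: ext j.+1 x <= ext j (x :&: W))%VS.
  apply: limg_ext_sub => w wx; rewrite lfunE /= (contract_wedge_proj _ e).
  apply: memv_suml => a _; apply: memvZ; apply: wedge_in_ext => b.
  by rewrite memv_cap We rpredB ?memvZ.
by have := S _ (memv_img _ tx); rewrite lfunE.
Qed.

Lemma contract_ext0 j (t : tens vT j.+1) : t \in ext j.+1 W -> contract lam t = 0.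
Proof.
case: lamP => _ lW _ tx.
have /subvP S : (linfun (@contract k vT j lam) @: ext j.+1 W <= 0)%VS.
  apply: limg_ext_sub => w wx; rewrite lfunE /= contract_wedge big1 ?mem0v // => a _.
  by rewrite lW // mulr0 scale0r.
by have := S _ (memv_img _ tx); rewrite lfunE memv0 => /eqP.
Qed.

Lemma extmul_ext j x (t : tens vT j) : e \in x ->
  t \in ext j x -> extmul e t \in ext j.+1 x.
Proof.
move=> ex tx.
have /subvP S : (linfun (@extmul k vT j e) @: ext j x <= ext j.+1 x)%VS.
  apply: limg_ext_sub => w wx; rewrite lfunE /= extmul_wedge.
  apply: wedge_in_ext => a.
  by case: (unliftP ord0 a) => [b|] ->; rewrite ?fcons0 ?fconsS.
by have := S _ (memv_img _ tx); rewrite lfunE.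
Qed.

(** By [wedge_proj] this operator is the exterior power of the projection onto [W] along [e]. *)
Lemma proj_ext j x (t : tens vT j.+1) : e \in x -> t \in ext j.+1 x ->
  t - extmul e (contract lam t) \in ext j.+1 (x :&: W)%VS.
Proof.
move=> ex tx; case: lamP => _ _ We.
pose f := (\1 - (linfun (@extmul k vT j e) \o linfun (@contract k vT j lam)))%VF.
have fE u : f u = u - extmul e (contract lam u).
  by rewrite add_lfunE id_lfunE opp_lfunE comp_lfunE !lfunE.
have /subvP S : (f @: ext j.+1 x <= ext j.+1 (x :&: W))%VS.
  apply: limg_ext_sub => w wx; rewrite fE wedge_proj.
  by apply: wedge_in_ext => a; rewrite memv_cap We rpredB ?memvZ.
by have := S _ (memv_img _ tx); rewrite fE.
Qed.

Lemma contract_extmul j (t : tens vT j) :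
  t \in ext j W -> contract lam (extmul e t) = t.
Proof.
move=> tx; case: lamP => le lW _.
pose f := ((linfun (@contract k vT j lam) \o linfun (@extmul k vT j e)) - \1)%VF.
have fE u : f u = contract lam (extmul e u) - u.
  by rewrite add_lfunE opp_lfunE id_lfunE comp_lfunE !lfunE.
have /subvP S : (f @: ext j W <= 0)%VS.
  apply: limg_ext_sub => w wx; rewrite fE extmul_wedge contract_wedge.
  rewrite big_ord_recl fcons0 le expr0 mulr1 scale1r big1 ?addr0 => [|a _]; last first.
    by rewrite fconsS lW // mulr0 scale0r.
  rewrite (@eq_wedge _ _ _ _ w) ?subrr ?mem0v // => b.
  exact: fconsS.
by have := S _ (memv_img _ tx); rewrite fE memv0 subr_eq0 => /eqP.
Qed.

Lemma contract_ext_eq0 j x (t : tens vT j.+1) : e \in x -> t \in ext j.+1 x ->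
  contract lam t = 0 -> t \in ext j.+1 (x :&: W)%VS.
Proof. by move=> ex /(proj_ext ex) + t0; rewrite t0 linear0 subr0. Qed.

(** Rank-nullity for the contraction: [contract_ext_eq0] gives the kernel, and [extmul e] is a
    section over the image. *)
Lemma dim_ext_split j x : e \in x ->
  \dim (ext j.+1 x) = (\dim (ext j.+1 (x :&: W)) + \dim (ext j (x :&: W)))%N.
Proof.
move=> ex; rewrite -(limg_ker_dim (linfun (@contract k vT j lam)) (ext j.+1 x)).
congr (_ + _)%N; congr (\dim _); apply/eqP; rewrite eqEsubv; apply/andP; split.
- apply/subvP => t; rewrite memv_cap memv_ker lfunE => /andP[tx /eqP].
  exact: contract_ext_eq0.
- apply/subvP => t ty; rewrite memv_cap memv_ker lfunE /= contract_ext0.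
    by rewrite eqxx andbT; apply: subvP ty; apply: extS; apply: capvSl.
  by apply: subvP ty; apply: extS; apply: capvSr.
- by apply/subvP => _ /memv_imgP[t tx ->]; rewrite lfunE; apply: contract_ext.
apply/subvP => t ty; rewrite -[t]contract_extmul.
  rewrite -(lfunE (@contract k vT j lam)); apply: memv_img; apply: extmul_ext => //.
  by apply: subvP ty; apply: extS; apply: capvSl.
by apply: subvP ty; apply: extS; apply: capvSr.
Qed.

End Fixed.

Lemma exists_hyperplane e : e != 0 ->
  exists W : {vspace vT}, (\dim W).+1 = \dim {:vT} /\ e \notin W.
Proof.
move=> e0; exists <[e]>^C%VS; split.
  rewrite dimv_compl dim_vline e0 subn1 prednK //.
  by apply: leq_trans (dimvS (subvf <[e]>)); rewrite dim_vline e0.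
apply: contra e0 => eC; rewrite -memv0 -(capv_compl <[e]>) memv_cap eC.
by rewrite memv_line.
Qed.

(** Induction on the dimension: [dim_ext_split] along a nonzero vector of [x] is Pascal's rule. *)
Lemma dim_ext j x : \dim (ext j x) = 'C(\dim x, j).
Proof.
have [d] := ubnP (\dim x); elim: d => // d IHd in j x *; rewrite ltnS => lexd.
case: j => [|j].
  by rewrite ext0 bin0 dimvf {1}/dim /= card_ffun !card_ord expn0 mul1n.
have [x0|x0] := eqVneq x 0%VS.
  rewrite x0 dimv0 bin0n; apply/eqP; rewrite dimv_eq0 -subv0 -[ext _ _]lim1g.
  apply: limg_ext_sub => w /(_ ord0); rewrite memv0 => /eqP w0.
  rewrite id_lfunE memv0; apply/eqP/ffunP => s.
  rewrite !ffunE (expand_det_row _ ord0) big1 // => b _.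
  by rewrite mxE w0 linear0 mul0r.
have ex := memv_pick x; have e0 : vpick x != 0 by rewrite vpick0.
have [W [dW eW]] := exists_hyperplane e0.
have [lam lamP] := exists_split_form dW eW.
have dx : \dim x = (\dim (x :&: W)).+1.
  by apply: dim_cap_hyperplane => //; apply: contra eW => /subvP; apply.
by rewrite (dim_ext_split lamP _ ex) dx binS !IHd -?dx.
Qed.

End Splitting.

(** * The boundary on chains and its cone decomposition at one hyperplane *)

Section Chains.
Variables (k : fieldType) (vT : vectType k) (m : nat).
Implicit Types (j p : nat) (a : 'I_m) (S D : {set 'I_m}).
Local Notation ch j := (chains vT m j).

HB.instance Definition _ j :=
  GRing.isLinear.Build k (ch j) (ch j) *:%R (@bd k vT m j) (bd_is_linear (j := j)).

Lemma epsU1 S i (c : 'I_m) :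
  i \notin S -> eps k (i |: S) c = (-1) ^+ (i < c)%N * eps k S c.
Proof.
move=> iS; rewrite /eps -exprD; congr (_ ^+ _).
have [ic|ic] := boolP (i < c)%N.
  rewrite -[RHS](_ : #|i |: [set b in S | (b < c)%N]| = _); last first.
    by rewrite cardsU1 inE (negPf iS).
  apply: eq_card => b; rewrite !inE; case: eqP => [->|_] //=; exact: ic.
apply: eq_card => b; rewrite !inE; case: eqP => [->|_] //=.
by rewrite (negPf ic) andbF.
Qed.

Lemma eps_sqr S i : eps k S i * eps k S i = 1.
Proof. by rewrite -expr2 sqrr_sign. Qed.

(** Exactly one of [a < i] and [i < a] holds, whence the minus sign. *)
Lemma eps_swap S i a : a \in S -> i \notin S ->
  eps k (i |: S) i * eps k (i |: S) a = - (eps k S a * eps k (i |: (S :\ a)) i).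
Proof.
move=> aS iS; rewrite !(epsU1 _ iS) epsU1 ?inE ?(negPf iS) ?andbF //.
rewrite -{1}(setD1K aS) epsU1 ?inE ?eqxx // !ltnn !expr0 !mul1r.
have nia : i != a by apply: contraNneq iS => ->.
rewrite mulrACA -exprD.
have -> : ((a < i) + (i < a))%N = 1%N.
  by case: (ltngtP a i) => // /val_inj E; rewrite E eqxx in nia.
by rewrite expr1 mulN1r mulrC.
Qed.

Definition avoids j a (c : ch j) := forall S, a \in S -> c S = 0.

(** The join with the apex [a]; the sign makes the face opposite to [a] equal to [y] itself. *)
Definition cone j a (y : ch j) : ch j :=
  [ffun S : {set 'I_m} => if a \in S then eps k S a *: y (S :\ a) else 0].

Lemma cone_is_linear j a : linear (@cone j a).
Proof.
move=> b c c'; apply/ffunP => S; rewrite !ffunE.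
case: ifP => _; last by rewrite scaler0 addr0.
by rewrite scalerDr !scalerA mulrC.
Qed.
HB.instance Definition _ j a :=
  GRing.isLinear.Build k (ch j) (ch j) *:%R (@cone j a) (cone_is_linear (j := j) a).

(** The face opposite to the apex returns [y] because [eps] squares to one; the other faces are
    cones again, with the sign of [eps_swap]. *)
Lemma bd_cone j a (y : ch j) : avoids a y -> bd (cone a y) = y - cone a (bd y).
Proof.
move=> ya; apply/ffunP => S; rewrite !ffunE.
have [aS|aS] := boolP (a \in S).
  rewrite ya // add0r (bigD1 a (P := fun i => i \notin S :\ a)) /= ?inE ?eqxx //.
  rewrite ya ?inE ?eqxx // scaler0 add0r scaler_sumr -sumrN.
  apply: eq_big => [i|i iS]; first by rewrite !inE; case: eqP => [->|]; rewrite ?aS ?andbT.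
  rewrite ffunE inE aS orbT !scalerA eps_swap // scaleNr.
  have ia : i != a by apply: contraNneq iS => ->.
  rewrite setDUl (_ : [set i] :\ a = [set i]) //.
  by apply/setP => b; rewrite !inE andbC; case: eqP => // ->; rewrite ia.
rewrite subr0 (bigD1 a) //= ffunE !inE eqxx setU1K // scalerA eps_sqr scale1r.
rewrite big1 ?addr0 // => i /andP[iS ia].
by rewrite ffunE !inE (negPf aS) orbF eq_sym (negPf ia) scaler0.
Qed.

Lemma avoids_bd j a (c : ch j) : avoids a c -> avoids a (bd c).
Proof.
move=> ca S aS; rewrite ffunE big1 // => i _.
by rewrite ca ?scaler0 // inE aS orbT.
Qed.

Lemma add_cone_eq0 j a (c z : ch j) : avoids a c -> avoids a z ->
  c + cone a z = 0 -> c = 0 /\ z = 0.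
Proof.
move=> ca za /ffunP E; split; apply/ffunP => S; rewrite ffunE.
  have [/ca //|aS] := boolP (a \in S).
  by have := E S; rewrite !ffunE (negPf aS) addr0.
have [/za //|aS] := boolP (a \in S).
have := E (a |: S); rewrite !ffunE ca ?inE ?eqxx // add0r setU1K //.
by move/eqP; rewrite scaler_eq0 signr_eq0 => /eqP.
Qed.

Definition deletion j a (c : ch j) : ch j :=
  [ffun S : {set 'I_m} => if a \in S then 0 else c S].
(** The sign cancels the one built into [cone]. *)
Definition restriction j a (c : ch j) : ch j :=
  [ffun S : {set 'I_m} => if a \in S then 0 else eps k (a |: S) a *: c (a |: S)].

Lemma avoids_deletion j a (c : ch j) : avoids a (deletion a c).
Proof. by move=> S aS; rewrite ffunE aS. Qed.

Lemma avoids_restriction j a (c : ch j) : avoids a (restriction a c).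
Proof. by move=> S aS; rewrite ffunE aS. Qed.

Lemma cone_decomp j a (c : ch j) : c = deletion a c + cone a (restriction a c).
Proof.
apply/ffunP => S; rewrite !ffunE; case: ifP => aS; last by rewrite addr0.
by rewrite !inE eqxx /= setD1K // scalerA eps_sqr scale1r add0r.
Qed.

Lemma bd_decomp j a (c : ch j) : bd c =
  (bd (deletion a c) + restriction a c) - cone a (bd (restriction a c)).
Proof.
rewrite {1}(cone_decomp a c) linearD /= bd_cone ?addrA //.
exact: avoids_restriction.
Qed.

(** The parts of [bd c] on sets without and with [a] vanish separately. *)
Lemma cycle_decomp j a (c : ch j) : bd c = 0 ->
  bd (deletion a c) = - restriction a c /\ bd (restriction a c) = 0.
Proof.
have del := avoids_bd (avoids_deletion (a := a) c).
have res := avoids_bd (avoids_restriction (a := a) c).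
rewrite (bd_decomp a) -linearN => /add_cone_eq0[].
- by move=> S aS; rewrite ffunE del // avoids_restriction // addr0.
- by move=> S aS; rewrite ffunE res // oppr0.
by move=> /eqP; rewrite addr_eq0 => /eqP -> /eqP; rewrite oppr_eq0 => /eqP ->.
Qed.

(** Induction on a set [D] supporting [c]: deletion and restriction are supported on [D :\ a], and
    by the cone formula the two remaining copies of [bd (restriction a c)] cancel. *)
Lemma bd_bd j (c : ch j) : bd (bd c) = 0.
Proof.
suff: forall D, (forall S, ~~ (S \subset D) -> c S = 0) -> bd (bd c) = 0.
  by move/(_ setT); apply=> S; rewrite subsetT.
move=> D; have [d] := ubnP #|D|; elim: d => // d IHd in c D *; rewrite ltnS => leDd cD.
have [D0|[a aD]] := set_0Vmem D.
  suff -> : bd c = 0 by rewrite linear0.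
  apply/ffunP => S; rewrite !ffunE big1 // => i _.
  rewrite cD ?scaler0 // D0 subset0; apply/set0Pn; exists i; rewrite !inE eqxx //.
have lD : (#|D :\ a| < d)%N by rewrite (cardsD1 a D) aD in leDd.
have sub S : ~~ (S \subset D :\ a) -> a \notin S -> ~~ (S \subset D).
  by rewrite subsetD1 => + aS; rewrite aS andbT.
have Ed : bd (bd (deletion a c)) = 0.
  apply: (IHd _ (D :\ a)) => // S nS; rewrite ffunE; case: ifPn => // aS.
  by rewrite cD // sub.
have Er : bd (bd (restriction a c)) = 0.
  apply: (IHd _ (D :\ a)) => // S nS; rewrite ffunE; case: ifPn => // aS.
  rewrite cD ?scaler0 //; apply: contra (sub _ nS aS); apply: subset_trans.
  exact: subsetUr.
rewrite (bd_decomp a c) linearB linearD /= Ed add0r bd_cone; last first.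
  by apply/avoids_bd/avoids_restriction.
by rewrite Er linear0 subr0 subrr.
Qed.

Definition cmap j j' (f : tens vT j -> tens vT j') (c : ch j) : ch j' :=
  [ffun S : {set 'I_m} => f (c S)].

Lemma cmap_is_linear j j' (f : {linear tens vT j -> tens vT j'}) :
  linear (@cmap j j' f).
Proof. by move=> a c c'; apply/ffunP => S; rewrite !ffunE linearP. Qed.
HB.instance Definition _ j j' (f : {linear tens vT j -> tens vT j'}) :=
  GRing.isLinear.Build k (ch j) (ch j') *:%R (@cmap j j' f)
    (cmap_is_linear f).

Lemma bd_cmap j j' (f : {linear tens vT j -> tens vT j'}) (c : ch j) :
  bd (cmap f c) = cmap f (bd c).
Proof.
apply/ffunP => S; rewrite !ffunE linear_sum; apply: eq_bigr => i _.
by rewrite linearZ ffunE.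
Qed.

End Chains.

(** * Vanishing of homology by deletion and restriction *)

Section Vanishing.
Variables (k : fieldType) (vT : vectType k) (m : nat) (H : 'I_m -> {vspace vT}).
Implicit Types (j p : nat) (a : 'I_m) (S D : {set 'I_m}) (X : {vspace vT}).
Local Notation ch j := (chains vT m j).

Lemma fS_sub S D : S \subset D -> (fS H D <= fS H S)%VS.
Proof.
move=> /subsetP SD; apply/subv_bigcapP => i iS.
exact: (bigcapv_inf _ (SD _ iS)).
Qed.

Lemma fSU1 a S : fS H (a |: S) = (H a :&: fS H S)%VS.
Proof.
apply/eqP; rewrite eqEsubv; apply/andP; split.
  rewrite subv_cap fS_sub ?subsetUr // andbT.
  by apply: (bigcapv_inf a); rewrite ?inE ?eqxx.
apply/subv_bigcapP => i /setU1P[->|iS]; first exact: capvSl.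
by apply: subv_trans (capvSr _ _) _; apply: (bigcapv_inf _ iS).
Qed.

Lemma fS0 : fS H set0 = fullv.
Proof. by rewrite /fS big_set0. Qed.

(** The traces of the hyperplanes on [X] may coincide or be all of [X], so restrictions stay within
    this class of complexes. *)
Definition coef D X j p S : {vspace tens vT j} :=
  if (S \subset D) && (#|S| == p) then ext j (X :&: fS H S)%VS else 0%VS.

Definition inK D X j p (c : ch j) := forall S, c S \in coef D X j p S.

Lemma inKD D X j p (c c' : ch j) :
  inK D X p c -> inK D X p c' -> inK D X p (c + c').
Proof. by move=> cK cK' S; rewrite ffunE rpredD. Qed.

Lemma inKN D X j p (c : ch j) : inK D X p c -> inK D X p (- c).
Proof. by move=> cK S; rewrite ffunE rpredN. Qed.

Lemma inK0 D X j p : inK D X p (0 : ch j).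
Proof. by move=> S; rewrite ffunE mem0v. Qed.

Lemma inKS D D' X X' j p (c : ch j) : D \subset D' -> (X <= X')%VS ->
  inK D X p c -> inK D' X' p c.
Proof.
move=> DD XX cK S; have := cK S; rewrite /coef.
case: ifP => [/andP[SD ->]|_]; last by rewrite memv0 => /eqP ->; apply: mem0v.
rewrite (subset_trans SD DD) /=; apply: subvP; apply: extS.
exact: capvS.
Qed.

Lemma inK_avoids D X j p a (c : ch j) : inK (D :\ a) X p c -> avoids a c.
Proof.
move=> cK S aS; have := cK S; rewrite /coef subsetD1 aS andbF /= memv0.
by move/eqP.
Qed.

Lemma inK_bd D X j p (c : ch j) : inK D X p.+1 c -> inK D X p (bd c).
Proof.
move=> cK S; rewrite ffunE; apply: memv_suml => i iS; apply: memvZ.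
have := cK (i |: S); rewrite /coef cardsU1 iS add1n eqSS.
have [/andP[SD ->]|_] := ifP; last by rewrite memv0 => /eqP ->; apply: mem0v.
rewrite (subset_trans (subsetUr _ _) SD) /=; apply: subvP; apply: extS.
by apply: capvS => //; apply/fS_sub/subsetUr.
Qed.

Lemma bd_inK0 D X j (c : ch j) : inK D X 0 c -> bd c = 0.
Proof.
move=> cK; apply/ffunP => S; rewrite !ffunE big1 // => i iS.
have := cK (i |: S); rewrite /coef cardsU1 iS andbF memv0 => /eqP ->.
by rewrite scaler0.
Qed.

Lemma inK_deletion D X j p a (c : ch j) :
  inK D X p c -> inK (D :\ a) X p (deletion a c).
Proof.
move=> cK S; have := cK S; rewrite ffunE /coef subsetD1.
by case: (a \in S) => /=; rewrite ?andbT ?andbF // mem0v.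
Qed.

Lemma inK_restriction D X j p a (c : ch j) :
  inK D X p.+1 c -> inK (D :\ a) (X :&: H a) p (restriction a c).
Proof.
move=> cK S; have := cK (a |: S); rewrite ffunE /coef subsetD1.
have [aS|aS] := boolP (a \in S); first by rewrite mem0v.
rewrite subUset cardsU1 aS add1n eqSS andbT fSU1 capvA.
have [/andP[/andP[_ ->] ->] /= cS|_] := ifP; first exact: memvZ.
by rewrite memv0 => /eqP ->; rewrite scaler0 mem0v.
Qed.

Lemma restriction_inK0 D X j a (c : ch j) : inK D X 0 c -> restriction a c = 0.
Proof.
move=> cK; apply/ffunP => S; rewrite !ffunE; case: ifPn => // aS.
have := cK (a |: S); rewrite /coef cardsU1 aS andbF memv0 => /eqP ->.
by rewrite scaler0.
Qed.

Lemma inK_cone D X j p a (c : ch j) : a \in D ->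
  inK (D :\ a) (X :&: H a) p c -> inK D X p.+1 (cone a c).
Proof.
move=> aD cK S; rewrite ffunE; have [aS|aS] := boolP (a \in S); last exact: mem0v.
have := cK (S :\ a); rewrite /coef subsetD1 -capvA -fSU1 setD1K //.
rewrite !inE eqxx andbT (cardsD1 a S) aS add1n eqSS.
have [/andP[SD ->] cS|_] := ifP; last by rewrite memv0 => /eqP ->; rewrite scaler0 mem0v.
rewrite -(setD1K aS) subUset sub1set aD SD /=; apply: memvZ.
by rewrite setD1K.
Qed.

Definition exactK D X j p :=
  forall c : ch j, inK D X p c -> bd c = 0 -> exists2 b, inK D X p.+1 b & bd b = c.

(** When cutting with [H a] leaves the coefficients unchanged, the cone over the deletion of a cycle
    is an admissible chain, and it bounds the cycle. *)
Lemma exactK_cone D X j p a : a \in D ->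
    (forall S, ext j (X :&: H a :&: fS H S) = ext j (X :&: fS H S)%VS) ->
  exactK D X j p.
Proof.
move=> aD eqX c cK /(cycle_decomp a)[dc _].
exists (cone a (deletion a c)).
  apply: inK_cone => // S; have := inK_deletion a cK S.
  by rewrite /coef eqX.
rewrite bd_cone; last exact: avoids_deletion.
by rewrite dc linearN opprK -cone_decomp.
Qed.

(** * Contraction and exterior multiplication by a vector of the common intersection *)

Section Transversal.
Variables (D : {set 'I_m}) (X W : {vspace vT}) (e : vT) (lam : {scalar vT}).
Hypotheses (lamP : split_form W e lam) (eU : e \in (X :&: fS H D)%VS).

Let eS S : S \subset D -> e \in (X :&: fS H S)%VS.
Proof. by move=> SD; apply: subvP eU; apply: capvS => //; apply: fS_sub. Qed.

Let capWC S : (X :&: W :&: fS H S = X :&: fS H S :&: W)%VS.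
Proof. by rewrite -!capvA (capvC W). Qed.

Lemma inK_contract j p (c : ch j.+1) :
  inK D X p c -> inK D (X :&: W) p (cmap (contract lam) c).
Proof.
move=> cK S; rewrite ffunE; have := cK S; rewrite /coef capWC.
case: ifP => [/andP[SD _]|_]; first exact: (contract_ext lamP (eS SD)).
by rewrite !memv0 => /eqP ->; rewrite linear0.
Qed.

Lemma inK_extmul j p (c : ch j) :
  inK D (X :&: W) p c -> inK D X p (cmap (extmul e) c).
Proof.
move=> cK S; rewrite ffunE; have := cK S; rewrite /coef capWC.
case: ifP => [/andP[SD _] cS|_]; last by rewrite !memv0 => /eqP ->; rewrite linear0.
apply: extmul_ext; first exact: eS.
by apply: subvP cS; apply: extS; apply: capvSl.
Qed.

Let inK_extW j p (c : ch j) S : inK D (X :&: W) p c -> c S \in ext j W.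
Proof.
move=> /(_ S); rewrite /coef capWC; case: ifP => _.
  by apply: subvP; apply: extS; apply: capvSr.
by rewrite memv0 => /eqP ->; apply: mem0v.
Qed.

Lemma cmap_contract_extmul j p (c : ch j) :
  inK D (X :&: W) p c -> cmap (contract lam) (cmap (extmul e) c) = c.
Proof.
by move=> cK; apply/ffunP => S; rewrite !ffunE (contract_extmul lamP (inK_extW S cK)).
Qed.

Lemma cmap_contract0 j p (c : ch j.+1) :
  inK D (X :&: W) p c -> cmap (contract lam) c = 0.
Proof.
by move=> cK; apply/ffunP => S; rewrite !ffunE (contract_ext0 lamP (inK_extW S cK)).
Qed.

Lemma inK_proj j p (c : ch j.+1) : inK D X p c ->
  inK D (X :&: W) p (c - cmap (extmul e) (cmap (contract lam) c)).
Proof.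
move=> cK S; rewrite !ffunE; have := cK S; rewrite /coef capWC.
case: ifP => [/andP[SD _]|_]; first exact: (proj_ext lamP (eS SD)).
by rewrite !memv0 => /eqP ->; rewrite !linear0 addr0.
Qed.

Lemma inK_contract_eq0 j p (c : ch j.+1) :
  inK D X p c -> cmap (contract lam) c = 0 -> inK D (X :&: W) p c.
Proof.
move=> /inK_proj + c0; rewrite c0 [cmap _ 0](_ : _ = 0) ?subr0 //.
by apply/ffunP => S; rewrite !ffunE linear0.
Qed.

End Transversal.

Hypothesis H_hyp : forall a, (\dim (H a)).+1 = \dim {:vT}.

(* When [H a] is transversal to the other hyperplanes, contraction with the
   form defining it identifies the quotient of the deletion by the restriction
   with the restriction in exterior degree one less. *)
Lemma exactK_transversal D X j p a : a \in D ->
    ~~ (X :&: fS H (D :\ a) <= H a)%VS ->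
    exactK (D :\ a) (X :&: H a) j p ->
  exactK D X j.+1 p.
Proof.
move=> aD /subvPn[e eU eH] exact c cK dc0.
have [dc dz] := cycle_decomp a dc0.
have [lam lamP] := exists_split_form (H_hyp a) eH.
set c' := deletion a c in dc *; set z := restriction a c in dc dz *.
have cK' : inK (D :\ a) X p c' by apply: inK_deletion.
(* The coefficients of [z] lie in exterior powers of subspaces of [H a], where [lam] vanishes; in
   degree 0, [z] itself is zero. *)
have cz : cmap (contract lam) z = 0.
  case: p cK {exact cK'} => [|p] cK.
    rewrite /z (restriction_inK0 a cK); apply/ffunP => S.
    by rewrite !ffunE linear0.
  exact: (cmap_contract0 lamP (inK_restriction a cK)).
have cE : c = c' + cone a z by apply: cone_decomp.
clearbody c' z.
have [||y yK dy] := exact (cmap (contract lam) c').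
- exact: (inK_contract lamP eU cK').
- rewrite bd_cmap dc; apply/ffunP => S; rewrite !ffunE linearN /=.
  by have /ffunP/(_ S) := cz; rewrite !ffunE => ->; rewrite oppr0.
(* Since [y'] lifts [y], the corrected chain [w] has zero contraction; its coefficients therefore
   lie inside [H a] and it can be coned off. *)
pose y' := cmap (extmul e) y; pose w := c' - bd y'.
have yK' : inK (D :\ a) X p.+1 y' by apply: (inK_extmul eU yK).
have wK : inK (D :\ a) (X :&: H a) p w.
  apply: (inK_contract_eq0 lamP eU).
    by apply: inKD cK' _; apply/inKN/inK_bd.
  apply/ffunP => S; rewrite !ffunE linearB /=.
  have /ffunP/(_ S) := dy.
  by rewrite -{1}(cmap_contract_extmul lamP yK) bd_cmap !ffunE => ->; rewrite subrr.
exists (y' + cone a w).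
  apply: inKD; last exact: inK_cone.
  by apply: inKS yK'; rewrite ?subD1set.
rewrite linearD /= bd_cone; last exact: inK_avoids wK.
by rewrite /w linearB /= bd_bd subr0 dc linearN opprK addrA addrCA subrr addr0.
Qed.

(** The long exact sequence of the mapping cone by hand: [y] fills the restriction, [b] fills the
    resulting cycle [c' + y] of the deletion, and [b - cone a y] fills [c]. *)
Lemma exactK_deletion D X j p a : a \in D ->
    exactK (D :\ a) X j p ->
    (forall p', p = p'.+1 -> exactK (D :\ a) (X :&: H a) j p') ->
  exactK D X j p.
Proof.
move=> aD exX exH c cK dc0; have [dc dz] := cycle_decomp a dc0.
set c' := deletion a c in dc *; set z := restriction a c in dc dz *.
have cK' : inK (D :\ a) X p c' by apply: inK_deletion.
have [y yK dy] : exists2 y, inK (D :\ a) (X :&: H a) p y & bd y = z.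
  case: p => [|p] in cK exH {exX cK'} *.
    by exists 0; rewrite ?linear0 /z ?(restriction_inK0 a cK) //; apply: inK0.
  by apply: exH => //; apply: inK_restriction.
have [||b bK db] := exX (c' + y).
- by apply: inKD => //; apply: inKS yK; rewrite ?capvSl.
- by rewrite linearD /= dc dy addNr.
exists (b - cone a y).
  apply: inKD; last by apply/inKN/inK_cone.
  by apply: inKS bK; rewrite ?subD1set.
rewrite linearB /= bd_cone; last exact: inK_avoids yK.
by rewrite db dy opprB addrA addrAC addrK -cone_decomp.
Qed.

Lemma exactK_vanishing D X j p :
  (p + j < \dim X - \dim (X :&: fS H D))%N || (\dim X < p + j)%N -> exactK D X j p.
Proof.
have [d] := ubnP #|D|; elim: d => // d IHd in D X j p *; rewrite ltnS => leDd.
have [->|[a aD]] := set_0Vmem D.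
  (* The rank is zero and only the empty set occurs, in degree 0, where [\dim X < j] kills the
     exterior power. *)
  rewrite fS0 capvf subnn ltn0 /= => ltXp c cK _; exists 0; first exact: inK0.
  rewrite linear0; apply/ffunP => S; rewrite ffunE; apply/esym/eqP; rewrite -memv0.
  have := cK S; rewrite /coef subset0; case: ifP => // /andP[/eqP ->].
  rewrite cards0 fS0 capvf => /eqP p0; rewrite -p0 add0n in ltXp.
  suff -> : ext j X = 0%VS by [].
  by apply/eqP; rewrite -dimv_eq0 dim_ext bin_small.
have lD : (#|D :\ a| < d)%N by rewrite (cardsD1 a D) aD in leDd.
case: j => [|j]; first by move=> _; apply: (exactK_cone aD) => S; rewrite !ext0.
have [XH _|XH] := boolP (X <= H a)%VS.
  by apply: (exactK_cone aD) => S; rewrite (capv_idPl XH).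
have dX := dim_cap_hyperplane (H_hyp a) XH.
have EU : (X :&: fS H D = X :&: H a :&: fS H (D :\ a))%VS.
  by rewrite -capvA -fSU1 setD1K.
rewrite EU dX.
have [UH|UH] := boolP (X :&: fS H (D :\ a) <= H a)%VS => hp.
  (* The deletion keeps the common intersection, hence the rank; the restriction loses one in rank
     and in dimension, which the shift from [p] to [p'] absorbs. *)
  apply: (exactK_deletion aD).
    apply: IHd => //; rewrite dX.
    suff <- : (X :&: H a :&: fS H (D :\ a) = X :&: fS H (D :\ a))%VS by [].
    by rewrite -capvA (capvC (H a)) capvA; apply/capv_idPl.
  have arith p' x u : (p'.+1 + j.+1 < x.+1 - u)%N || (x.+1 < p'.+1 + j.+1)%N ->
    (p' + j.+1 < x - u)%N || (x < p' + j.+1)%N by lia.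
  by move=> p' pE; apply: IHd => //; apply: arith; rewrite -pE.
(* In the transversal case the same loss is absorbed by the shift from [j.+1] to [j]. *)
have arith x u : (p + j.+1 < x.+1 - u)%N || (x.+1 < p + j.+1)%N ->
  (p + j < x - u)%N || (x < p + j)%N by lia.
by apply: (exactK_transversal aD UH); apply: IHd => //; apply: arith.
Qed.

End Vanishing.

(** * Dimensions of the homology *)

Section Dimensions.
Variables (k : fieldType) (vT : vectType k) (m : nat) (H : 'I_m -> {vspace vT}).
Implicit Types (j p : nat) (S : {set 'I_m}) (X : {vspace vT}).
Local Notation ch j := (chains vT m j).

Lemma single_is_linear j S : linear (@single k vT m j S).
Proof.
move=> a t t'; apply/ffunP => Y; rewrite !ffunE.
by case: ifP => // _; rewrite scaler0 addr0.
Qed.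
HB.instance Definition _ j S :=
  GRing.isLinear.Build k (tens vT j) (ch j) *:%R (@single k vT m j S)
    (single_is_linear (j := j) S).

Definition chspace j (g : {set 'I_m} -> {vspace tens vT j}) : {vspace ch j} :=
  (\sum_S linfun (@single k vT m j S) @: g S)%VS.

Lemma sum_single j (us : {set 'I_m} -> tens vT j) :
  \sum_S single S (us S) = [ffun S => us S].
Proof.
apply/ffunP => Y; rewrite sum_ffunE !ffunE (bigD1 Y) //= ffunE eqxx big1 ?addr0 //.
by move=> S SY; rewrite ffunE eq_sym (negPf SY).
Qed.

Lemma chspaceP j (g : {set 'I_m} -> {vspace tens vT j}) (c : ch j) :
  reflect (forall S, c S \in g S) (c \in chspace g).
Proof.
apply: (iffP memv_sumP) => [[us usg ->] S|cg].
  rewrite sum_ffunE memv_suml // => S' _.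
  have /memv_imgP[t tg ->] := usg S' isT; rewrite lfunE ffunE.
  by case: eqP => [->|_] //; apply: mem0v.
exists (fun S => single S (c S)) => [S _|].
  by rewrite -(lfunE (@single k vT m j S)); apply: memv_img.
by rewrite sum_single; apply/ffunP => S; rewrite ffunE.
Qed.

Lemma dim_chspace j (g : {set 'I_m} -> {vspace tens vT j}) :
  \dim (chspace g) = (\sum_S \dim (g S))%N.
Proof.
have dir : directv (\sum_S linfun (@single k vT m j S) @: g S).
  apply/directv_sum_independent => us usg us0 S _.
  have /memv_imgP[t _ E] := usg S isT; rewrite E lfunE.
  have /ffunP/(_ S) := us0; rewrite sum_ffunE ffunE (bigD1 S) //= E lfunE ffunE eqxx.
  rewrite big1 ?addr0 => [->|S' SS']; first exact: linear0.
  have /memv_imgP[t' _ ->] := usg S' isT; rewrite lfunE ffunE eq_sym.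
  by rewrite (negPf SS').
rewrite /chspace (directvP dir); apply: eq_bigr => S _.
apply: limg_dim_eq; apply/eqP; rewrite -subv0; apply/subvP => t.
rewrite memv_cap memv_ker lfunE => /andP[_ /eqP/ffunP/(_ S)].
by rewrite !ffunE eqxx => ->; apply: mem0v.
Qed.

Definition Kspace X j p : {vspace ch j} := chspace (coef H setT X j p).

Lemma KspaceP X j p (c : ch j) :
  reflect (inK H setT X p c) (c \in Kspace X j p).
Proof. exact: chspaceP. Qed.

Lemma Cgrp_Kspace j p : Cgrp H j p = Kspace fullv j p.
Proof.
rewrite /Cgrp /Kspace /chspace [LHS]big_mkcond /=; apply: eq_bigr => S _.
by rewrite /coef subsetT capfv /=; case: ifP => // _; rewrite limg0.
Qed.

Definition Zspace X j p := (Kspace X j p :&: lker (linfun (@bd k vT m j)))%VS.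
Definition Bspace X j p := (linfun (@bd k vT m j) @: Kspace X j p)%VS.
(** Integer-valued, to avoid truncated subtraction in Euler characteristics and sums. *)
Definition hdim X j p : int := (\dim (Zspace X j p))%:Z - (\dim (Bspace X j p.+1))%:Z.

Lemma ZspaceP X j p (c : ch j) :
  reflect (inK H setT X p c /\ bd c = 0) (c \in Zspace X j p).
Proof.
rewrite memv_cap memv_ker lfunE /=.
by apply: (iffP andP) => [[/KspaceP ? /eqP]|[? ->]] //; split => //; apply/KspaceP.
Qed.

Lemma BspaceP X j p (b : ch j) :
  reflect (exists2 c, inK H setT X p c & b = bd c) (b \in Bspace X j p).
Proof.
apply: (iffP memv_imgP) => [[c /KspaceP cK ->]|[c cK ->]].
  by exists c; rewrite ?lfunE.
by exists c; rewrite ?lfunE //; apply/KspaceP.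
Qed.

Lemma Bspace_sub X j p : (Bspace X j p.+1 <= Zspace X j p)%VS.
Proof.
apply/subvP => _ /BspaceP[c cK ->]; apply/ZspaceP.
by rewrite bd_bd; split => //; apply: inK_bd.
Qed.

Lemma dimHC_hdim p j : (dimHC H p j)%:Z = hdim fullv j p.
Proof.
rewrite /dimHC Cgrp_Kspace Cgrp_Kspace -subzn //.
exact: dimvS (Bspace_sub fullv j p).
Qed.

Lemma exactK_hdim0 X j p : exactK H setT X j p -> hdim X j p = 0.
Proof.
move=> ex; apply/eqP; rewrite subr_eq0 eqz_nat eqn_leq (dimvS (Bspace_sub _ _ _)) andbT.
apply/dimvS/subvP => c /ZspaceP[cK dc]; apply/BspaceP.
by have [b bK <-] := ex c cK dc; exists b.
Qed.

Lemma Bspace0 X j : Bspace X j 0 = 0%VS.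
Proof.
apply/eqP; rewrite -subv0; apply/subvP => _ /BspaceP[c cK ->].
by rewrite (bd_inK0 cK) mem0v.
Qed.

Lemma Bspace_gt X j p : (m < p)%N -> Bspace X j p = 0%VS.
Proof.
move=> mp; apply/eqP; rewrite -subv0; apply/subvP => _ /BspaceP[c cK ->].
suff -> : c = 0 by rewrite linear0 mem0v.
apply/ffunP => S; have := cK S; rewrite /coef ffunE.
rewrite (_ : #|S| == p = false) ?andbF ?memv0; first by move/eqP.
by apply/eqP => E; have := max_card S; rewrite E card_ord leqNgt mp.
Qed.

Lemma euler_hdim X j M : (m < M)%N ->
  \sum_(p < M) (-1) ^+ p * hdim X j p =
  \sum_(S : {set 'I_m}) (-1) ^+ #|S| * ('C(\dim (X :&: fS H S)%VS, j))%:Z.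
Proof.
move=> mM.
(* Rank-nullity telescopes up to the term of [Bspace X j N], which is zero once [N] exceeds [m]. *)
have tele N : \sum_(p < N) (-1) ^+ p * (\dim (Kspace X j p))%:Z =
    \sum_(p < N) (-1) ^+ p * hdim X j p - (-1) ^+ N * (\dim (Bspace X j N))%:Z.
  elim: N => [|N IHN]; first by rewrite !big_ord0 Bspace0 dimv0 mulr0 subr0.
  rewrite !big_ord_recr /= IHN -(limg_ker_dim (linfun (@bd k vT m j)) (Kspace X j N)).
  rewrite -/(Zspace X j N) -/(Bspace X j N) /hdim PoszD exprS; ring.
have := tele M; rewrite Bspace_gt // dimv0 mulr0 subr0 => <-.
under eq_bigr => p _.
  rewrite dim_chspace (big_morph Posz PoszD (erefl _)) mulr_sumr.
  over.
rewrite exchange_big /=; apply: eq_bigr => S _.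
have SM : (#|S| < M)%N.
  by apply: leq_trans mM; rewrite ltnS -[m in (_ <= m)%N]card_ord max_card.
rewrite (bigD1 (Ordinal SM)) //= /coef subsetT eqxx dim_ext big1 ?addr0 // => p.
rewrite -val_eqE /= => /negPf pS.
by rewrite eq_sym pS ?andbF dimv0 mulr0.
Qed.

(** * Splitting off a line of the common intersection *)

Section Peel.
Variables (X W : {vspace vT}) (e : vT) (lam : {scalar vT}).
Hypotheses (lamP : split_form W e lam) (eU : e \in (X :&: fS H setT)%VS).

(** Rank-nullity for the contraction on cycles; exterior multiplication by [e] commutes with [bd]
    and supplies preimages. *)
Lemma dim_Zspace_peel j p : \dim (Zspace X j.+1 p) =
  (\dim (Zspace (X :&: W) j.+1 p) + \dim (Zspace (X :&: W) j p))%N.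
Proof.
pose f := linfun (@cmap k vT m _ _ (@contract k vT j lam)).
rewrite -(limg_ker_dim f); congr (_ + _)%N; congr (\dim _).
  apply/vspaceP => c; rewrite memv_cap memv_ker lfunE /=.
  apply/andP/ZspaceP => [[/ZspaceP[cK dc] /eqP c0]|[cK dc]].
    by split => //; apply: (inK_contract_eq0 lamP eU).
  split; last by rewrite (cmap_contract0 lamP cK).
  by apply/ZspaceP; split => //; apply: inKS cK => //; apply: capvSl.
apply/vspaceP => y; apply/memv_imgP/ZspaceP => [[c /ZspaceP[cK dc] ->]|[yK dy]].
  by rewrite lfunE /= bd_cmap dc linear0; split => //; apply: (inK_contract lamP eU).
exists (cmap (extmul e) y); last by rewrite lfunE /= (cmap_contract_extmul lamP yK).
by apply/ZspaceP; rewrite bd_cmap dy linear0; split => //; apply: (inK_extmul eU).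
Qed.

Lemma dim_Bspace_peel j p : \dim (Bspace X j.+1 p) =
  (\dim (Bspace (X :&: W) j.+1 p) + \dim (Bspace (X :&: W) j p))%N.
Proof.
pose f := linfun (@cmap k vT m _ _ (@contract k vT j lam)).
rewrite -(limg_ker_dim f); congr (_ + _)%N; congr (\dim _).
  apply/vspaceP => b; rewrite memv_cap memv_ker lfunE /=.
  apply/andP/BspaceP => [[/BspaceP[c cK ->] /eqP c0]|[c cK ->]].
    (* Removing the [e]-part moves [c] into [X :&: W]; the boundary is unchanged because [bd c] has
       zero contraction. *)
    exists (c - cmap (extmul e) (cmap (contract lam) c)).
      exact: (inK_proj lamP eU).
    by rewrite linearB /= !bd_cmap c0 linear0 subr0.
  split; last by rewrite -bd_cmap (cmap_contract0 lamP cK) linear0.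
  by apply/BspaceP; exists c => //; apply: inKS cK => //; apply: capvSl.
apply/vspaceP => y; apply/memv_imgP/BspaceP => [[b /BspaceP[c cK ->] ->]|[c cK ->]].
  rewrite lfunE /= -bd_cmap; exists (cmap (contract lam) c) => //.
  exact: (inK_contract lamP eU).
exists (bd (cmap (extmul e) c)); last first.
  by rewrite lfunE /= -bd_cmap (cmap_contract_extmul lamP cK).
by apply/BspaceP; exists (cmap (extmul e) c) => //; apply: (inK_extmul eU).
Qed.

Lemma hdim_peel j p : hdim X j.+1 p = hdim (X :&: W) j.+1 p + hdim (X :&: W) j p.
Proof. by rewrite /hdim dim_Zspace_peel dim_Bspace_peel !PoszD; ring. Qed.

End Peel.

Lemma hdim_deg0 X X' p : hdim X 0 p = hdim X' 0 p.
Proof.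
have E q : Kspace X 0 q = Kspace X' 0 q.
  by apply/vspaceP => c; apply/chspaceP/chspaceP => cK S; have := cK S;
    rewrite /coef !ext0.
by rewrite /hdim /Zspace /Bspace !E.
Qed.

Hypothesis H_hyp : forall a, (\dim (H a)).+1 = \dim {:vT}.

Lemma hdimE X j p u (r := (\dim X - u)%N) : \dim (X :&: fS H setT) = u ->
  hdim X j p = if (p <= r <= p + j)%N then
    ('C(u, p + j - r))%:Z * (-1) ^+ p *
      \sum_(S : {set 'I_m}) (-1) ^+ #|S| * ('C(\dim (X :&: fS H S)%VS - u, r - p))%:Z
  else 0.
Proof.
rewrite {}/r => Eu; elim: u => [|v IHv] in X j Eu *.
  (* With zero common intersection the rank is [\dim X], so for fixed [j] only the degree with
     [p + j = \dim X] survives and carries the whole Euler characteristic. *)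
  rewrite subn0; have [pj|pj] := eqVneq (p + j)%N (\dim X); last first.
    rewrite exactK_hdim0; last by apply: exactK_vanishing => //; rewrite Eu; lia.
    case: ifP => // /andP[pX Xp]; rewrite bin0n.
    by rewrite (_ : (_ == _)%N = false) ?mul0r //; lia.
  rewrite -pj leq_addr leqnn /= subnn bin0 mul1r addKn.
  under eq_bigr do rewrite subn0.
  (* This bound exceeds [m] and also makes [p] one of the summands. *)
  rewrite -(@euler_hdim X j (m + p).+1) ?ltnS ?leq_addr //.
  have pM : (p < (m + p).+1)%N by rewrite ltnS leq_addl.
  rewrite (bigD1 (Ordinal pM)) //= big1 ?addr0 => [|q].
    by rewrite mulrA -expr2 sqrr_sign mul1r.
  rewrite -val_eqE /= => qp; rewrite exactK_hdim0 ?mulr0 //.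
  by apply: exactK_vanishing => //; rewrite Eu; lia.
pose U := (X :&: fS H setT)%VS; pose e := vpick U.
have e0 : e != 0 by rewrite vpick0 -dimv_eq0 Eu.
have eU : e \in U by apply: memv_pick.
have [W [dW eW]] := exists_hyperplane e0.
have [lam lamP] := exists_split_form dW eW.
have dcap (Y : {vspace vT}) : e \in Y -> \dim Y = (\dim (Y :&: W)).+1.
  by move=> eY; apply: dim_cap_hyperplane => //; apply: contra eW => /subvP; apply.
have dX : \dim X = (\dim (X :&: W)).+1 by apply: dcap; move: eU; rewrite memv_cap => /andP[].
have dS S : \dim (X :&: fS H S) = (\dim (X :&: W :&: fS H S)).+1.
  rewrite -capvA (capvC W) capvA; apply: dcap; apply: subvP eU.
  by apply: capvS => //; apply/fS_sub/subsetT.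
have dU : \dim (X :&: W :&: fS H setT) = v by apply/eqP; rewrite -eqSS -dS Eu.
(* Every dimension drops by one, so the rank and the differences in the sum do not change. *)
under eq_bigr do rewrite dS subSS.
rewrite dX subSS.
(* In exterior degree 0 nothing depends on [X], and the condition forces [p] to be the rank, where
   the binomial is 1. *)
case: j => [|j].
  rewrite (hdim_deg0 X (X :&: W)) IHv //; case: ifP => // h.
  by rewrite (_ : (p + 0 - _)%N = 0%N) ?bin0 //; lia.
rewrite (hdim_peel lamP eU) !IHv //; set r := (_ - v)%N.
have [pr|pr] := boolP (p <= r)%N; last by rewrite /= addr0.
rewrite /=; case: (ltngtP r (p + j.+1)%N) => rp.
- have -> : (r <= p + j)%N by lia.
  have -> : (p + j.+1 - r)%N = (p + j - r).+1 by lia.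
  by rewrite binS PoszD; ring.
- have -> : (r <= p + j)%N = false by lia.
  by rewrite addr0.
have -> : (r <= p + j)%N = false by lia.
by rewrite rp subnn !bin0 addr0.
Qed.

End Dimensions.

(** * Whitney's theorem and the characteristic polynomial *)

Section Whitney.
Variables (k : fieldType) (vT : vectType k) (m : nat) (H : 'I_m -> {vspace vT}).
Implicit Types (S T : {set 'I_m}) (y z : {vspace vT}).
Local Notation n := (\dim {:vT}).

(** Expand the product of the [F i + 1]: it has a zero factor as soon as [T] is non-empty. *)
Lemma sum_sign_subset T :
  \sum_(S : {set 'I_m} | S \subset T) (-1) ^+ #|S| = (T == set0)%:R :> int.
Proof.
pose F i : int := if i \in T then -1 else 0.
have := @bigA_distr int 0 1 *%R +%R _ F (fun=> 1).
have -> : \prod_i (F i + 1) = (T == set0)%:R :> int.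
  have [T0|[i iT]] := set_0Vmem T.
    by rewrite T0 eqxx big1 // => i _; rewrite /F T0 inE add0r.
  rewrite (bigD1 i) //= /F iT addNr mul0r; case: eqP => // T0.
  by rewrite T0 inE in iT.
move=> ->; rewrite big_mkcond; apply: eq_bigr => S _ /=.
have [/subsetP ST|/subsetPn[i iS iT]] := boolP (S \subset T); last first.
  by rewrite (bigD1 i) //= iS /F (negPf iT) mul0r.
rewrite -big_mkcond /= (eq_bigr (fun=> -1)) ?prodr_const // => i /ST iT.
by rewrite /F iT.
Qed.

Definition signed_count (y : {vspace vT}) : int :=
  \sum_(S : {set 'I_m} | fS H S == y) (-1) ^+ #|S|.

Lemma fS_Lat S : fS H S \in Lat H.
Proof. by rewrite mem_undup; apply: map_f; rewrite mem_enum. Qed.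

Lemma sum_Lat (M : zmodType) (G : {vspace vT} -> M) :
  \sum_(z <- Lat H) G z *~ signed_count z =
  \sum_(S : {set 'I_m}) G (fS H S) *~ (-1) ^+ #|S|.
Proof.
under eq_bigr do rewrite mulrz_sumr.
rewrite (exchange_big_dep xpredT) //=; apply: eq_bigr => S _.
rewrite -big_filter (_ : [seq z <- Lat H | fS H S == z] = [:: fS H S]) ?big_seq1 //.
rewrite (eq_filter (a2 := pred1 (fS H S))); last by move=> z; rewrite eq_sym.
by rewrite filter_pred1_uniq ?undup_uniq ?fS_Lat.
Qed.

Hypothesis H_hyp : forall a, (\dim (H a)).+1 = n.

(** The families whose intersection contains [y] are the subsets of [T], the hyperplanes containing
    [y], so [sum_sign_subset] applies. This is the recursion defining the Moebius function. *)
Lemma sum_signed_count y : y \in Lat H ->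
  \sum_(z <- Lat H | (y <= z)%VS) signed_count z = (y == fullv)%:R.
Proof.
rewrite mem_undup => /mapP[S0 _ yE].
pose T := [set i | (y <= H i)%VS].
have subT S : (y <= fS H S)%VS = (S \subset T).
  apply/subv_bigcapP/subsetP => yS i iS; first by rewrite inE yS.
  by have := yS i iS; rewrite inE.
(* No hyperplane contains the full space; conversely [y] is the intersection of a family inside
   [T]. *)
have -> : (y == fullv) = (T == set0).
  apply/eqP/eqP => [yf|T0].
    apply/setP => i; rewrite !inE yf; apply/negP => /dimvS.
    by rewrite -(H_hyp i) ltnn.
  have : S0 \subset T by rewrite -subT yE.
  by rewrite T0 subset0 => /eqP S00; rewrite yE S00 fS0.
rewrite -sum_sign_subset big_mkcond /=.
rewrite (eq_bigr (fun z => ((y <= z)%VS%:R : int) *~ signed_count z)); last first.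
  by move=> z _; case: (y <= z)%VS; rewrite ?mul0rz // -mulrzr mul1r intz.
rewrite sum_Lat [RHS]big_mkcond; apply: eq_bigr => S _; rewrite subT.
by case: (S \subset T); rewrite ?mul0rz // -mulrzr mul1r intz.
Qed.

(** Recursive calls go to strictly larger subspaces, so the codimension of [y] is enough fuel;
    without fuel only the full space remains. *)
Lemma mob_fuelE f y : y \in Lat H -> (n - \dim y <= f)%N ->
  mob_fuel H f y = signed_count y.
Proof.
have rec z : z \in Lat H -> signed_count z +
    \sum_(z' <- Lat H | (z <= z')%VS && (z != z')) signed_count z' = (z == fullv)%:R.
  move=> zL; rewrite -(sum_signed_count zL) [RHS]big_mkcond (bigD1_seq z) ?undup_uniq //=.
  rewrite subvv -big_mkcondr; congr (_ + _).
  by apply: eq_bigl => z'; rewrite (eq_sym z) andbC.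
elim: f y => [|f IHf] y yL yf /=.
  have yF : y = fullv by apply/eqP; rewrite eqEdim subvf /=; lia.
  have := rec _ yL; rewrite yF eqxx big1_seq ?addr0 // => z /andP[/andP[]].
  by move=> fz; rewrite eqEsubv fz subvf.
case: eqP => [yF|/eqP yF].
  have := rec _ yL; rewrite yF eqxx big1_seq ?addr0 // => z /andP[/andP[]].
  by move=> fz; rewrite eqEsubv fz subvf.
have := rec _ yL; rewrite (negPf yF) => /eqP; rewrite addr_eq0 => /eqP ->.
congr (- _); rewrite big_seq_cond [RHS]big_seq_cond.
apply: eq_bigr => z /and3P[zL yz nyz]; apply: IHf => //.
have : (\dim y < \dim z)%N.
  by rewrite ltnNge; apply: contra nyz => h; rewrite eqEdim yz h.
by have := dimvS (subvf z); lia.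
Qed.

Lemma mobLE y : y \in Lat H -> mobL H y = signed_count y.
Proof. by move=> yL; apply: mob_fuelE => //; rewrite ltnW // ltnS leq_subr. Qed.

Lemma chiLE : chiL H = \sum_(S : {set 'I_m})
  'X^(\dim (fS H S) - \dim (Uarr H)) *~ (-1) ^+ #|S|.
Proof.
rewrite -(sum_Lat (fun z => 'X^(\dim z - \dim (Uarr H)) : {poly rat})).
apply: eq_big_seq => z zL; rewrite mobLE //.
by rewrite scaler_int.
Qed.

(** The derivative of a power of ['X] at 1 is a falling factorial, that is, [q!] times a
    binomial. *)
Lemma derivn_chiL q : (chiL H)^`(q).[1] = q`!%:R *
  (\sum_(S : {set 'I_m})
    (-1) ^+ #|S| * ('C(\dim (fS H S) - \dim (Uarr H), q))%:Z)%:~R :> rat.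
Proof.
rewrite chiLE linear_sum /= horner_sum rmorph_sum mulr_sumr.
apply: eq_bigr => S _ /=.
rewrite raddfMz /= derivnXn hornerMz hornerMn hornerXn expr1n -bin_ffact.
by rewrite -mulrzr natrM intrM -pmulrn; ring.
Qed.

End Whitney.

Theorem theorem10 (k : fieldType) (iota : {rmorphism k -> Cplx})
  (vT : vectType k) (m : nat) (H : 'I_m -> {vspace vT})
  (H_inj : injective H)
  (H_hyp : forall a, (\dim (H a)).+1 = \dim {:vT})
  (rk_ge2 : (2 <= rkL H)%N) (i j : nat) :
  (~~ [&& (i < rkL H)%N, (rkL H <= i + j)%N & (i + j <= \dim {:vT})%N] ->
     dimHC H i j = 0%N) /\
  ([&& (i < rkL H)%N, (rkL H <= i + j)%N & (i + j <= \dim {:vT})%N] ->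
     (dimHC H i j)%:R =
       (-1) ^+ i / ((rkL H - i)`!)%:R * ('C(\dim (Uarr H), i + j - rkL H))%:R
       * (chiL H)^`(rkL H - i).[1] :> rat).
Proof.
have hE : (dimHC H i j)%:Z = if (i <= rkL H <= i + j)%N then
    ('C(\dim (Uarr H), i + j - rkL H))%:Z * (-1) ^+ i *
      \sum_(S : {set 'I_m})
        (-1) ^+ #|S| * ('C(\dim (fS H S) - \dim (Uarr H), rkL H - i))%:Z
    else 0.
  rewrite dimHC_hdim (hdimE H_hyp _ _ (erefl _)) capfv.
  by under eq_bigr do rewrite capfv.
split=> [|/and3P[ir rij _]].
  move=> hn; apply/eqP; rewrite -eqz_nat {}hE; case: ifP => // /andP[ir rij].
  have [ltir|leri] := ltnP i (rkL H).
    (* Here [i + j] exceeds the dimension of the space, so [i + j - rkL H] exceeds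
       [\dim (Uarr H)]. *)
    rewrite bin_small ?mul0r //; move: hn; rewrite ltir rij /= -ltnNge.
    by rewrite /rkL; have := dimvS (subvf (Uarr H)); lia.
  (* Now [i] equals the rank and all binomials in the sum are 1; the signs over all families cancel,
     because positive rank makes the arrangement non-empty. *)
  have -> : (rkL H - i = 0)%N by lia.
  under eq_bigr do rewrite bin0 mulr1.
  have -> : \sum_(S : {set 'I_m}) (-1) ^+ #|S| = ([set: 'I_m] == set0)%:R :> int.
    by rewrite -sum_sign_subset; apply: eq_bigl => S; rewrite subsetT.
  have [T0|_] := eqVneq [set: 'I_m] set0; last by rewrite mulr0.
  by move: rk_ge2; rewrite /rkL /Uarr T0 fS0 subnn.
rewrite derivn_chiL // -[LHS](_ : (Posz (dimHC H i j))%:~R = _) // hE (ltnW ir) rij.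
rewrite !intrM -pmulrn rmorphXn rmorphN1 /=.
by field; rewrite pnatr_eq0 -lt0n fact_gt0.
Qed.
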